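(* Let $\ell$ be an odd prime, let $t\ge2$ be an integer, and let $\alpha\in\mathbb{Z}_\ell^t\setminus(\ell\mathbb{Z}_\ell)^t$ be an admissible vector. If $\ell>t$, then $\lambda_\ell(X_t,\alpha)<2t$.
   Context: For $b\in\mathbb{Z}_\ell$ put $\binom{b}{n}=\frac{b(b-1)\cdots(b-n+1)}{n!}\in\mathbb{Z}_\ell$ and $(1+T)^b=\sum_{n\ge0}\binom{b}{n}T^n\in\mathbb{Z}_\ell[[T]]$. The bouquet $X_t$ is the multigraph with one vertex and $t$ undirected loops; a vector $\alpha=(\alpha_1,\dots,\alpha_t)\in\mathbb{Z}_\ell^t$ assigns the voltage $\alpha_j$ to the $j$-th loop. It is admissible if $\alpha\in\mathbb{Z}_\ell^t\setminus(\ell\mathbb{Z}_\ell)^t$. The characteristic series is $$f(T)=f_{X_t,\alpha}(T)=\sum_{j=1}^t\big(2-(1+T)^{\alpha_j}-(1+T)^{-\alpha_j}\big)\in\mathbb{Z}_\ell[[T]].$$ For admissible $\alpha$ it is nonzero, and it has zero constant term. By Weierstrass preparation write $f(T)=\ell^{\mu}g(T)u(T)$ with $\mu\in\mathbb{Z}_{\ge0}$, $g$ a distinguished polynomial (monic, all non-leading coefficients divisible by $\ell$) and $u\in\mathbb{Z}_\ell[[T]]^\times$. Then $\mu_\ell(X_t,\alpha):=\mu$ and $\lambda_\ell(X_t,\alpha):=\deg g-1$ (note the shift by $-1$). *)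

(* Defs.v *)
From HB Require Import structures.
From mathcomp Require Import all_boot all_order all_algebra.
From mathcomp Require Import boolp classical_sets.

Set Implicit Arguments.
Unset Strict Implicit.
Unset Printing Implicit Defensive.

Import Order.TTheory GRing.Theory Num.Theory.
Local Open Scope ring_scope.

Section ClassicalInverse.
Variable R : comNzRingType.

Definition classical_unit : {pred R} := fun x => `[< exists y, y * x = 1 >].
Definition classical_inv (x : R) : R := xget x [set y | y * x = 1]%classic.

Lemma classical_mulVx : {in classical_unit, left_inverse 1 classical_inv *%R}.
Proof.
by move=> x /asboolP; apply: (@xgetPex _ x [set y | y * x = 1]%classic).
Qed.

Lemma classical_unitPl x y : y * x = 1 -> classical_unit x.
Proof. by move=> yx1; apply/asboolP; exists y. Qed.

Lemma classical_inv_out : {in [predC classical_unit], classical_inv =1 id}.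
Proof.
move=> x /negP nux; apply: xgetPN => y /= yx1.
by apply: nux; apply: classical_unitPl yx1.
Qed.

End ClassicalInverse.

(* The inverse limit of the rings Z/l^(n+1): [x n] is the residue of x modulo *)
(* l^(n+1).  For l <= 1 the convention on 'Z_m makes this a junk ring.        *)
Record padic_int (l : nat) := PadicInt {
  padic_val :> forall n : nat, 'Z_(l ^ n.+1);
  padic_compat : forall n : nat,
    (padic_val n.+1 : nat)%:R = padic_val n :> 'Z_(l ^ n.+1) }.

HB.instance Definition _ l := gen_eqMixin (padic_int l).
HB.instance Definition _ l := gen_choiceMixin (padic_int l).

Section PadicRing.
Variable l : nat.
Implicit Types x y z : padic_int l.

Lemma padic_eqP x y : (forall n, x n = y n) -> x = y.
Proof.
case: x y => [x cx] [y cy] /= exy.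
have {exy} exy : x = y by apply: functional_extensionality_dep.
by case: y / exy cy => cy; congr PadicInt; apply: Prop_irrelevance.
Qed.

Lemma padic_dvd_modulus n :
  ((Zp_trunc (l ^ n.+1)).+2 %| (Zp_trunc (l ^ n.+2)).+2)%N.
Proof.
case: (ltngtP l 1) => [| l1 |->]; last by rewrite !exp1n.
  by case: l => //= _; rewrite !exp0n.
have lP k : (1 < l ^ k.+1)%N by rewrite -(exp1n k.+1) ltn_exp2r.
by rewrite !Zp_cast // dvdn_exp2l.
Qed.

Lemma padic_red n k :
  (k %% (Zp_trunc (l ^ n.+2)).+2)%N%:R = k%:R :> 'Z_(l ^ n.+1).
Proof.
by apply: val_inj; rewrite /= !Zp_nat /= modn_dvdm // padic_dvd_modulus.
Qed.

Fact padic0_subproof n :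
  ((0%R : 'Z_(l ^ n.+2)) : nat)%:R = 0 :> 'Z_(l ^ n.+1).
Proof. by []. Qed.
Definition padic0 := PadicInt padic0_subproof.

Fact padic1_subproof n :
  ((1%R : 'Z_(l ^ n.+2)) : nat)%:R = 1 :> 'Z_(l ^ n.+1).
Proof. by []. Qed.
Definition padic1 := PadicInt padic1_subproof.

Fact padicD_subproof x y n :
  (((x n.+1 + y n.+1)%R : 'Z_(l ^ n.+2)) : nat)%:R = x n + y n :> 'Z_(l ^ n.+1).
Proof. by rewrite padic_red natrD !padic_compat. Qed.
Definition padicD x y := PadicInt (padicD_subproof x y).

Fact padicN_subproof x n :
  (((- x n.+1)%R : 'Z_(l ^ n.+2)) : nat)%:R = - x n :> 'Z_(l ^ n.+1).
Proof.
apply/eqP; rewrite -addr_eq0; apply/eqP.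
by rewrite -[x n]padic_compat -natrD -padic_red -[X in X%:R]/(val (- x n.+1 + x n.+1)) addNr.
Qed.
Definition padicN x := PadicInt (padicN_subproof x).

Fact padicM_subproof x y n :
  (((x n.+1 * y n.+1)%R : 'Z_(l ^ n.+2)) : nat)%:R = x n * y n :> 'Z_(l ^ n.+1).
Proof. by rewrite padic_red natrM !padic_compat. Qed.
Definition padicM x y := PadicInt (padicM_subproof x y).

Lemma padicDA : associative padicD.
Proof. by move=> x y z; apply: padic_eqP => n /=; rewrite addrA. Qed.
Lemma padicDC : commutative padicD.
Proof. by move=> x y; apply: padic_eqP => n /=; rewrite addrC. Qed.
Lemma padicD0 : left_id padic0 padicD.
Proof. by move=> x; apply: padic_eqP => n /=; rewrite add0r. Qed.
Lemma padicDN : left_inverse padic0 padicN padicD.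
Proof. by move=> x; apply: padic_eqP => n /=; rewrite addNr. Qed.
HB.instance Definition _ :=
  GRing.isZmodule.Build (padic_int l) padicDA padicDC padicD0 padicDN.

Lemma padicMA : associative padicM.
Proof. by move=> x y z; apply: padic_eqP => n /=; rewrite mulrA. Qed.
Lemma padicMC : commutative padicM.
Proof. by move=> x y; apply: padic_eqP => n /=; rewrite mulrC. Qed.
Lemma padicM1 : left_id padic1 padicM.
Proof. by move=> x; apply: padic_eqP => n /=; rewrite mul1r. Qed.
Lemma padicMD : left_distributive padicM padicD.
Proof. by move=> x y z; apply: padic_eqP => n /=; rewrite mulrDl. Qed.
Lemma padic1_neq0 : padic1 != 0.
Proof.
apply/eqP => /(congr1 (fun x : padic_int l => x 0%N)) /= /eqP.
by rewrite oner_eq0.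
Qed.
HB.instance Definition _ := GRing.Zmodule_isComNzRing.Build (padic_int l)
  padicMA padicMC padicM1 padicMD padic1_neq0.

HB.instance Definition _ := GRing.ComNzRing_hasMulInverse.Build (padic_int l)
  (@classical_mulVx (padic_int l)) (@classical_unitPl (padic_int l))
  (@classical_inv_out (padic_int l)).

Lemma padic_valD x y n : (x + y) n = x n + y n. Proof. by []. Qed.
Lemma padic_valN x n : (- x) n = - x n. Proof. by []. Qed.
Lemma padic_valM x y n : (x * y) n = x n * y n. Proof. by []. Qed.
Lemma padic_val0 n : (0 : padic_int l) n = 0. Proof. by []. Qed.
Lemma padic_val1 n : (1 : padic_int l) n = 1. Proof. by []. Qed.
Lemma padic_val_nat k n : (k%:R : padic_int l) n = k%:R.
Proof. by elim: k => // k IH; rewrite -natr1 padic_valD IH natr1. Qed.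
Lemma padic_valX x k n : (x ^+ k) n = x n ^+ k.
Proof. by elim: k => // k IH; rewrite !exprS padic_valM IH. Qed.
Lemma padic_val_sum I (r : seq I) (P : pred I) (F : I -> padic_int l) n :
  (\sum_(i <- r | P i) F i) n = \sum_(i <- r | P i) F i n.
Proof. by elim/big_rec2: _ => // i a b _ <-. Qed.
Lemma padic_val_prod I (r : seq I) (P : pred I) (F : I -> padic_int l) n :
  (\prod_(i <- r | P i) F i) n = \prod_(i <- r | P i) F i n.
Proof. by elim/big_rec2: _ => // i a b _ <-. Qed.

End PadicRing.

Record fps (R : Type) := FPS { fps_coef :> nat -> R }.

HB.instance Definition _ R := gen_eqMixin (fps R).
HB.instance Definition _ R := gen_choiceMixin (fps R).

Section FpsRing.
Variable R : comNzRingType.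
Implicit Types f g h : fps R.

Lemma fpsP f g : (forall n, f n = g n) -> f = g.
Proof. by case: f g => [f] [g] /= fg; congr FPS; apply: funext. Qed.

Definition fps_poly (p : {poly R}) : fps R := FPS (fun n => p`_n).

Definition fps0 : fps R := FPS (fun=> 0).
Definition fps1 : fps R := FPS (fun n => (n == 0%N)%:R).
Definition fpsD f g : fps R := FPS (fun n => f n + g n).
Definition fpsN f : fps R := FPS (fun n => - f n).
Definition fpsM f g : fps R :=
  FPS (fun n => \sum_(i < n.+1) f i * g (n - i)%N).

Lemma fpsDA : associative fpsD.
Proof. by move=> f g h; apply: fpsP => n /=; rewrite addrA. Qed.
Lemma fpsDC : commutative fpsD.
Proof. by move=> f g; apply: fpsP => n /=; rewrite addrC. Qed.
Lemma fpsD0 : left_id fps0 fpsD.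
Proof. by move=> f; apply: fpsP => n /=; rewrite add0r. Qed.
Lemma fpsDN : left_inverse fps0 fpsN fpsD.
Proof. by move=> f; apply: fpsP => n /=; rewrite addNr. Qed.
HB.instance Definition _ :=
  GRing.isZmodule.Build (fps R) fpsDA fpsDC fpsD0 fpsDN.

Let trunc N f : {poly R} := \poly_(i < N.+1) f i.
Let truncE N f n : (n <= N)%N -> (trunc N f)`_n = f n.
Proof. by move=> nN; rewrite coef_poly ltnS nN. Qed.
Let truncM N f g n : (n <= N)%N -> (fpsM f g) n = (trunc N f * trunc N g)`_n.
Proof.
move=> nN; rewrite coefM /=; apply: eq_bigr => i _.
by rewrite !truncE // (leq_trans _ nN) ?leq_subr // -ltnS.
Qed.

Lemma fpsMC : commutative fpsM.
Proof.
by move=> f g; apply: fpsP => n; rewrite !(@truncM n) // mulrC.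
Qed.
Lemma fpsMA : associative fpsM.
Proof.
move=> f g h; apply: fpsP => n.
have H u v w : (fpsM (fpsM u v) w) n = (trunc n u * trunc n v * trunc n w)`_n.
  rewrite coefM /=; apply: eq_bigr => i _.
  rewrite truncE ?leq_subr //; congr (_ * _).
  by rewrite -truncM // -ltnS.
by rewrite fpsMC !H -[in RHS]mulrA [in RHS]mulrC.
Qed.
Lemma fpsM1 : left_id fps1 fpsM.
Proof.
move=> f; apply: fpsP => n /=; rewrite big_ord_recl /= mul1r subn0 big1 ?addr0 //.
by move=> i _; rewrite mul0r.
Qed.
Lemma fpsMD : left_distributive fpsM fpsD.
Proof.
move=> f g h; apply: fpsP => n /=; rewrite -big_split /=.
by apply: eq_bigr => i _; rewrite mulrDl.
Qed.
Lemma fps1_neq0 : fps1 != 0.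
Proof.
by apply/eqP => /(congr1 (fun f : fps R => f 0%N)) /= /eqP; rewrite oner_eq0.
Qed.
HB.instance Definition _ := GRing.Zmodule_isComNzRing.Build (fps R)
  fpsMA fpsMC fpsM1 fpsMD fps1_neq0.

HB.instance Definition _ := GRing.ComNzRing_hasMulInverse.Build (fps R)
  (@classical_mulVx (fps R)) (@classical_unitPl (fps R))
  (@classical_inv_out (fps R)).

End FpsRing.

Section Iwasawa.
Variable l : nat.
Local Notation Zl := (padic_int l).

(* The quotient b (b - 1) ... (b - n + 1) / n! in Z_l: as n! need not be a    *)
(* unit, it is the c such that n! c = b (b - 1) ... (b - n + 1); existence    *)
(* and uniqueness for l prime are padic_binP and padic_bin_uniq below.        *)
Definition padic_bin (b : Zl) (n : nat) : Zl :=
  xget 0 [set c : Zl | n`!%:R * c = \prod_(i < n) (b - i%:R)]%classic.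

Definition pow1T (b : Zl) : fps Zl := FPS (padic_bin b).

Definition admissible (t : nat) (alpha : 'I_t -> Zl) : Prop :=
  ~ (forall j, exists c : Zl, alpha j = l%:R * c).

Definition bouquet_series (t : nat) (alpha : 'I_t -> Zl) : fps Zl :=
  \sum_(j < t) (2%:R - pow1T (alpha j) - pow1T (- alpha j)).

Definition distinguished (g : {poly Zl}) : Prop :=
  g \is monic /\
  (forall i, (i < (size g).-1)%N -> exists c : Zl, g`_i = l%:R * c).

Definition weierstrass_form (f : fps Zl) (d : nat * {poly Zl}) : Prop :=
  distinguished d.2 /\
  exists2 u : fps Zl, u \is a GRing.unit &
    f = l%:R ^+ d.1 * fps_poly d.2 * u.

(* Meaningful for l prime and f nonzero: see weierstrass_preparation and      *)
(* weierstrass_uniq below.                                                    *)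
Definition weierstrass (f : fps Zl) : nat * {poly Zl} :=
  xget (0%N, 0) [set d | weierstrass_form f d]%classic.

Definition mu_inv (t : nat) (alpha : 'I_t -> Zl) : nat :=
  (weierstrass (bouquet_series alpha)).1.

(* The outer "- 1" is part of the definition of lambda. *)
Definition lambda_inv (t : nat) (alpha : 'I_t -> Zl) : int :=
  ((size (weierstrass (bouquet_series alpha)).2).-1)%:Z - 1.

End Iwasawa.

Section PadicTheory.
Variable l : nat.
Hypothesis l_pr : prime l.
Local Notation Zl := (padic_int l).
Implicit Types x y z : Zl.

Let lX n : (1 < l ^ n.+1)%N.
Proof. by rewrite -(exp1n n.+1) ltn_exp2r // prime_gt1. Qed.

Lemma padic_val_mod x n k : ((x (k + n)%N : nat) %% l ^ n.+1)%N = x n.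
Proof.
elim: k => [|k IH]; first by rewrite add0n modn_small // -{2}(Zp_cast (lX n)).
rewrite -IH addSn; set a := (x (k + n).+1 : nat).
rewrite -(padic_compat x (k + n)) val_Zp_nat // modn_dvdm //.
by rewrite dvdn_exp2l // ltnS leq_addl.
Qed.

Lemma padic_of_nat (s : nat -> nat) :
  (forall n, s n.+1 = s n %[mod l ^ n.+1]) ->
  exists x : Zl, forall n, x n = (s n)%:R.
Proof.
move=> Hs; have cs n : (((s n.+1)%:R : 'Z_(l ^ n.+2)) : nat)%:R = (s n)%:R
    :> 'Z_(l ^ n.+1).
  have -> : (((s n.+1)%:R : 'Z_(l ^ n.+2)) : nat) =
      (s n.+1 %% (Zp_trunc (l ^ n.+2)).+2)%N by rewrite Zp_nat.
  rewrite padic_red -(Zp_nat_mod (lX n)) Hs.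
  by rewrite Zp_nat_mod.
by exists (PadicInt cs).
Qed.

Lemma padic_val_eq0 x n :
  x n = 0 <-> exists c, x = (l ^ n.+1)%:R * c.
Proof.
split=> [xn0 | [c ->]]; last by rewrite padic_valM padic_val_nat pchar_Zp ?mul0r.
pose s k := ((x (k + n.+1)%N : nat) %/ l ^ n.+1)%N.
have sE k : (x (k + n.+1)%N : nat) = (s k * l ^ n.+1)%N.
  rewrite [LHS](divn_eq _ (l ^ n.+1)) -/(s k).
  by rewrite -addSnnS padic_val_mod xn0 addn0.
have [|c cE] := @padic_of_nat s.
  move=> k; apply/eqP; rewrite -(eqn_pmul2r (ltnW (lX n))) !muln_modl.
  rewrite -!sE -expnD addSn; apply/eqP.
  by rewrite -[in RHS](padic_val_mod x _ 1) add1n modn_mod.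
exists c; apply: padic_eqP => k.
rewrite padic_valM padic_val_nat cE -natrM mulnC -sE.
apply: ord_inj; rewrite val_Zp_nat // addnC.
by rewrite padic_val_mod.
Qed.

Lemma padic_l_reg x : l%:R * x = 0 -> x = 0.
Proof.
move=> lx0; apply: padic_eqP => n; rewrite padic_val0.
have : (l%:R * x) n.+1 = 0 by rewrite lx0.
rewrite padic_valM padic_val_nat -[x n.+1]natr_Zp -natrM.
move/(congr1 (@nat_of_ord _)); rewrite val_Zp_nat // => /eqP.
move: (padic_val_mod x n 1); rewrite add1n; move: (nat_of_ord (x n.+1)) => a.
move=> ax; rewrite -/(dvdn _ _) expnS dvdn_pmul2l ?prime_gt0 // => /eqP d.
by apply: ord_inj; rewrite -ax d.
Qed.

Lemma padic_lX_reg k x : l%:R ^+ k * x = 0 -> x = 0.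
Proof.
elim: k => [|k IH]; first by rewrite mul1r.
by rewrite exprS -mulrA => /padic_l_reg.
Qed.

Lemma padic_res_unit x : x 0%N != 0 -> x \is a GRing.unit.
Proof.
move=> x0; have ux n : x n \is a GRing.unit.
  rewrite -[x n]natr_Zp (unitZpE _ (lX n)) coprimeXl // prime_coprime //.
  apply: contra x0 => /eqP d; apply/eqP/ord_inj.
  by rewrite /= -(padic_val_mod x 0 n) addn0 expn1 d.
have cy n : (((x n.+1)^-1 : 'Z_(l ^ n.+2)) : nat)%:R = (x n)^-1
    :> 'Z_(l ^ n.+1).
  apply: (mulrI (ux n)); rewrite (divrr (ux n)).
  rewrite -[x n]padic_compat -natrM -padic_red.
  exact: (congr1 (fun u : 'Z_(l ^ n.+2) => (u : nat)%:R : 'Z_(l ^ n.+1))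
                 (divrr (ux n.+1))).
apply/asboolP; exists (PadicInt cy); apply: padic_eqP => n.
by rewrite padic_valM (mulVr (ux n)).
Qed.

Lemma padic_unit_res x : x \is a GRing.unit -> x 0%N != 0.
Proof.
move=> ux; apply/eqP => x0; have : (x^-1 * x) 0%N = 1 by rewrite mulVr.
by rewrite padic_valM x0 mulr0 => /esym/eqP; rewrite oner_eq0.
Qed.

Lemma padic_nat_unit k : ~~ (l %| k)%N -> (k%:R : Zl) \is a GRing.unit.
Proof.
move=> lk; apply: padic_res_unit; apply: contra lk => /eqP.
by rewrite padic_val_nat => /(congr1 (@nat_of_ord _)); rewrite val_Zp_nat // => /eqP.
Qed.

Lemma padic_nat_reg k x : (0 < k)%N -> k%:R * x = 0 -> x = 0.
Proof.
move=> k0; have [m lm ->] := pfactor_coprime l_pr k0.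
rewrite mulnC natrM natrX -mulrA => /padic_lX_reg mx0.
have um : (m%:R : Zl) \is a GRing.unit.
  by apply: padic_nat_unit; rewrite -prime_coprime.
by apply: (mulrI um); rewrite mx0 mulr0.
Qed.

Lemma padic_sep x : (forall n, exists r, x = l%:R ^+ n * r) -> x = 0.
Proof.
move=> H; apply: padic_eqP => n; have [r ->] := H n.+1.
by rewrite padic_valM padic_valX padic_val_nat -natrX pchar_Zp ?mul0r.
Qed.

Lemma padic_sum_cvg (y : nat -> Zl) :
  exists s, forall n, exists r,
    s = \sum_(i < n) l%:R ^+ i * y i + l%:R ^+ n * r.
Proof.
pose S n := \sum_(i < n) l%:R ^+ i * y i.
have cs n : ((S n.+2 n.+1) : nat)%:R = S n.+1 n.
  have -> : S n.+2 = S n.+1 + l%:R ^+ n.+1 * y n.+1 by rewrite /S big_ord_recr.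
  rewrite padic_compat padic_valD padic_valM padic_valX.
  by rewrite padic_val_nat -natrX pchar_Zp // mul0r addr0.
exists (PadicInt cs) => -[|n].
  by exists (PadicInt cs); rewrite big_ord0 add0r mul1r.
have : (PadicInt cs - S n.+1) n = 0 by rewrite padic_valD padic_valN /= subrr.
by case/padic_val_eq0 => r e; exists r; rewrite -natrX -e addrC subrK.
Qed.

Lemma ffact_natr (R : comNzRingType) a n :
  (a ^_ n)%:R = \prod_(i < n) (a%:R - i%:R) :> R.
Proof.
elim: n => [|n IH]; first by rewrite big_ord0.
rewrite ffactnSr natrM IH big_ord_recr /=.
have [na|an] := leqP n a; first by rewrite natrB.
by rewrite -IH ffact_small // !mul0r.
Qed.

Lemma padic_binP (b : Zl) n :
  n`!%:R * padic_bin b n = \prod_(i < n) (b - i%:R).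
Proof.
apply: (@xgetPex _ 0 [set c | n`!%:R * c = \prod_(i < n) (b - i%:R)]%classic).
have [m lm fE] := pfactor_coprime l_pr (fact_gt0 n).
set v := logn l n`! in fE; have um : (m%:R : Zl) \is a GRing.unit.
  by apply: padic_nat_unit; rewrite -prime_coprime.
pose a : nat := b v.
have /padic_val_eq0[e eE] :
    (\prod_(i < n) (b - i%:R) - (a ^_ n)%:R : Zl) v = 0.
  rewrite padic_valD padic_valN padic_val_prod padic_val_nat ffact_natr.
  apply/eqP; rewrite subr_eq0; apply/eqP; apply: eq_bigr => i _.
  by rewrite padic_valD padic_valN padic_val_nat natr_Zp.
exists ('C(a, n)%:R + l%:R * e * m%:R^-1) => /=.
rewrite mulrDr -natrM mulnC bin_ffact -[RHS](subrK (a ^_ n)%:R) addrC eE.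
congr (_ + _); rewrite fE mulnC natrM natrX expnS natrM natrX.
rewrite -[LHS]mulrA [m%:R * _]mulrC divrK //.
by rewrite mulrA [_ * l%:R]mulrC.
Qed.

Lemma padic_bin_uniq (b c : Zl) n :
  n`!%:R * c = \prod_(i < n) (b - i%:R) -> c = padic_bin b n.
Proof.
rewrite -padic_binP => /eqP; rewrite -subr_eq0 -mulrBr => /eqP.
by move=> /(padic_nat_reg (fact_gt0 n))/eqP; rewrite subr_eq0 => /eqP.
Qed.

End PadicTheory.

Section FpsTheory.
Variable R : comNzRingType.
Implicit Types f g h : fps R.

Lemma fps_coefD f g n : (f + g) n = f n + g n. Proof. by []. Qed.
Lemma fps_coefN f n : (- f) n = - f n. Proof. by []. Qed.
Lemma fps_coef0 n : (0 : fps R) n = 0. Proof. by []. Qed.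
Lemma fps_coef1 n : (1 : fps R) n = (n == 0%N)%:R. Proof. by []. Qed.
Lemma fps_coefM f g n : (f * g) n = \sum_(i < n.+1) f i * g (n - i)%N.
Proof. by []. Qed.
Lemma fps_coef_sum I (r : seq I) (P : pred I) (F : I -> fps R) n :
  (\sum_(i <- r | P i) F i) n = \sum_(i <- r | P i) F i n.
Proof. by elim/big_rec2: _ => // i a b _ <-. Qed.
Lemma fps_coef_natM k f n : (k%:R * f) n = k%:R * f n.
Proof.
rewrite !mulr_natl; elim: k => // k IH.
by rewrite !mulrS fps_coefD IH.
Qed.
Lemma fps_coef_natXM k e f n : (k%:R ^+ e * f) n = k%:R ^+ e * f n.
Proof. by rewrite -!natrX fps_coef_natM. Qed.

Lemma fps_coefXnM k f n :
  (fps_poly 'X^k * f) n = if (n < k)%N then 0 else f (n - k)%N.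
Proof.
rewrite fps_coefM /=; case: ltnP => [nk|kn].
  rewrite big1 // => i _; rewrite coefXn.
  by rewrite (ltn_eqF (leq_ltn_trans _ nk)) ?mul0r // -ltnS.
have kn' : (k < n.+1)%N by [].
rewrite (bigD1 (Ordinal kn')) //= coefXn eqxx mul1r big1 ?addr0 // => i ik.
rewrite coefXn (_ : (i : nat) == k = false) ?mul0r //.
by apply: contraNF ik => /eqP ik; apply/eqP/val_inj.
Qed.

End FpsTheory.

Lemma fps_unit (R : comUnitRingType) (f : fps R) :
  f 0%N \is a GRing.unit -> f \is a GRing.unit.
Proof.
move=> uf; pose next (s : seq R) :=
  (f 0%N)^-1 * ((size s == 0%N)%:R - \sum_(i < size s) f i.+1 * s`_(size s - i.+1)).
pose s n := iter n (fun s => rcons s (next s)) [::].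
have ss n : size (s n) = n by elim: n => //= n IH; rewrite size_rcons IH.
have sE n k : (k < n)%N -> (s n)`_k = next (s k).
  elim: n => // n IH; rewrite ltnS leq_eqVlt => /orP[/eqP->|kn].
    by rewrite /= nth_rcons ss ltnn eqxx.
  by rewrite /= nth_rcons ss kn IH.
apply/asboolP; exists (FPS (fun k => next (s k))); apply: fpsP => n.
rewrite mulrC fps_coefM /= big_ord_recl /= subn0 {1}/next ss mulrA divrr // mul1r.
rewrite -addrA [X in _ + X](_ : _ = 0) ?addr0 // addrC.
apply/eqP; rewrite subr_eq0; apply/eqP; apply: eq_bigr => i _.
have ni : (n - i.+1 < n)%N by rewrite ltn_subrL (leq_trans _ (ltn_ord i)).
by rewrite /bump /= add1n sE.
Qed.

Section Weierstrass.
Variable l : nat.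
Hypothesis l_pr : prime l.
Local Notation Zl := (padic_int l).
Implicit Types (f g u : fps Zl) (p : {poly Zl}).

Let l0 : ((l%:R : Zl) 0%N = 0).
Proof. by rewrite padic_val_nat pchar_Zp // expn1 prime_gt1. Qed.

Lemma distinguished_res p u n : distinguished p -> u \is a GRing.unit ->
  (n <= (size p).-1)%N ->
  ((fps_poly p * u) n 0%N == 0) = (n < (size p).-1)%N.
Proof.
move=> [pm pd] uu; have u0 : u 0%N 0%N != 0.
  apply: padic_unit_res; apply/asboolP; exists (u^-1 0%N).
  have := congr1 (fun f : fps Zl => f 0%N) (mulVr uu).
  by rewrite /= big_ord_recl big_ord0 addr0 subnn.
have p0 i : (i < (size p).-1)%N -> p`_i 0%N = 0.
  by move=> /pd[c ->]; rewrite padic_valM l0 mul0r.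
rewrite fps_coefM padic_val_sum leq_eqVlt => /orP[/eqP->|ns].
  rewrite ltnn big_ord_recr /= big1 => [|i _]; last first.
    by rewrite p0 ?mul0r // ltn_ord.
  have e : p`_(size p).-1 0%N = 1.
    by rewrite -[p`__]/(lead_coef p) (monicP pm).
  by rewrite e subnn add0r mul1r; apply: negbTE.
rewrite ns big1 ?eqxx // => i _; rewrite padic_valM /= p0 ?mul0r //.
by apply: leq_ltn_trans ns; rewrite -ltnS.
Qed.

Lemma weierstrass_uniq f d e :
  weierstrass_form f d -> weierstrass_form f e ->
  d.1 = e.1 /\ (size d.2).-1 = (size e.2).-1.
Proof.
wlog: d e / (d.1 <= e.1)%N.
  by move=> H; case: (leqP d.1 e.1) => [/H//|/ltnW/H h fd fe];
     case: (h fe fd).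
case: d e => [a p] [b q] /= ab [/= pd [u uu fE]] [/= qd [v vv]].
rewrite fE -(subnKC ab) exprD -!mulrA; set k := (b - a)%N => /eqP.
rewrite -subr_eq0 -mulrBr => /eqP H.
have {}H n : (fps_poly p * u) n = l%:R ^+ k * (fps_poly q * v) n.
  apply/eqP; rewrite -subr_eq0; apply/eqP; apply: (@padic_lX_reg _ l_pr a).
  have := congr1 (fun g : fps Zl => g n) H.
  by rewrite fps_coef_natXM fps_coefD fps_coefN fps_coef_natXM.
have k0 : k = 0%N.
  apply/eqP; rewrite -leqn0 leqNgt; apply/negP => k0.
  have := distinguished_res pd uu (leqnn _); rewrite ltnn H padic_valM.
  by rewrite -(prednK k0) exprS padic_valM l0 !mul0r eqxx.
split; first by rewrite k0 addn0.
have {}H n : (fps_poly p * u) n = (fps_poly q * v) n by rewrite H k0 mul1r.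
have D r w : distinguished r -> w \is a GRing.unit ->
  (forall n, (fps_poly r * w) n = (fps_poly p * u) n) ->
  (size p).-1 = (size r).-1.
  move=> rd ww E; case: (ltngtP (size p).-1 (size r).-1) => // h.
    have := distinguished_res rd ww (ltnW h); rewrite h E.
    by rewrite (distinguished_res pd uu (leqnn _)) ltnn.
  have := distinguished_res pd uu (ltnW h); rewrite h -E.
  by rewrite (distinguished_res rd ww (leqnn _)) ltnn.
by apply: (D q v).
Qed.

Lemma fps_content f : f != 0 ->
  exists mu F, f = l%:R ^+ mu * F /\ exists n, F n 0%N != 0.
Proof.
move=> f0; have ex : exists k, `[< exists n, f n k != 0 >].
  apply: contrapT => H; case/eqP: f0; apply: fpsP => n; apply: padic_eqP => k.
  apply/eqP/negPn/negP => nz; apply: H; exists k; apply/asboolP; by exists n.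
case: (ex_minnP ex) => k /asboolP[n0 n0P] kmin.
have /choice[F FE] : forall n, exists c, f n = l%:R ^+ k * c.
  move=> n; case: k kmin {n0P} => [|k] kmin; first by exists (f n); rewrite mul1r.
  have /eqP/(padic_val_eq0 l_pr)[c cE] : f n k == 0.
    apply/negPn/negP => nz; suff: (k.+1 <= k)%N by rewrite ltnn.
    by apply: kmin; apply/asboolP; exists n.
  by exists c; rewrite -natrX.
exists k, (FPS F); split.
  by apply: fpsP => n; rewrite fps_coef_natXM FE.
exists n0; apply: contra n0P => /eqP /= /(padic_val_eq0 l_pr)[c cE].
apply/eqP; rewrite FE cE expn1 mulrA -exprSr -natrX.
by apply/(padic_val_eq0 l_pr); exists c.
Qed.

Definition fps_drop n f : fps Zl := FPS (fun i => f (i + n)%N).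

Lemma fps_dropD n f g : fps_drop n (f + g) = fps_drop n f + fps_drop n g.
Proof. by apply: fpsP. Qed.

Lemma fps_drop_natXM n k e f :
  fps_drop n (k%:R ^+ e * f) = k%:R ^+ e * fps_drop n f.
Proof. by apply: fpsP => i; rewrite fps_coef_natXM; apply: fps_coef_natXM. Qed.

Lemma fps_sum_cvg (y : nat -> fps Zl) :
  exists s : fps Zl, forall n, exists r,
    s = \sum_(i < n) l%:R ^+ i * y i + l%:R ^+ n * r.
Proof.
have /choice[s sP] := fun k => padic_sum_cvg l_pr (fun i => y i k).
exists (FPS s) => n.
have /choice[r rP] := fun k => sP k n.
exists (FPS r); apply: fpsP => k.
rewrite fps_coefD fps_coef_natXM fps_coef_sum [LHS]rP.
by congr (_ + _); apply: eq_bigr => i _; rewrite fps_coef_natXM.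
Qed.

(* Solution of Z + l tau(W Z) = 1, where tau drops the first n coefficients. *)
Lemma fps_fixpoint n (W : fps Zl) :
  exists Z : fps Zl, Z + l%:R * fps_drop n (W * Z) = 1.
Proof.
pose A z := - fps_drop n (W * z).
pose y i := iter i A 1.
have [Z ZP] := fps_sum_cvg y; exists Z.
apply/eqP; rewrite -subr_eq0; apply/eqP.
have AD a b : A (a + b) = A a + A b.
  by rewrite /A mulrDr fps_dropD opprD.
have AX e a : A (l%:R ^+ e * a) = l%:R ^+ e * A a.
  by rewrite /A mulrCA fps_drop_natXM mulrN.
have AE z : l%:R * fps_drop n (W * z) = - (l%:R * A z) by rewrite mulrN opprK.
apply: fpsP => i; apply: (padic_sep l_pr) => m.
suff [r ->] : exists r, Z + l%:R * fps_drop n (W * Z) - 1 = l%:R ^+ m * r.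
  by exists (r i); rewrite fps_coef_natXM.
have [r rE] := ZP m; rewrite AE rE.
exists (r - y m - l%:R * A r).
have S k : \sum_(i < k) l%:R ^+ i * y i
    - l%:R * A (\sum_(i < k) l%:R ^+ i * y i) = 1 - l%:R ^+ k * y k.
  elim: k => [|k IH].
    rewrite !big_ord0 /A mulr0 mul1r subrr (_ : fps_drop n 0 = 0) //.
    by rewrite oppr0 mulr0 subrr.
  rewrite !big_ord_recr /= AD AX mulrDr opprD addrACA IH -[A (y k)]/(y k.+1).
  by rewrite addrA subrK mulrA -exprS.
rewrite AD AX mulrDr opprD addrACA S mulrCA -!mulrBr.
by rewrite !mulrBr !addrA [LHS]addrC !addrA addNr add0r [RHS]addrAC
  -[LHS]addrA addrC.
Qed.

Let quot_eq (R : comNzRingType) (c p u v z x : R) : v * u = 1 ->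
  v * z * (c * p + x * u) = c * (p * v * z) + x * z.
Proof.
move=> vu; rewrite mulrDr; congr (_ + _).
  by rewrite mulrCA -[p * v * z]mulrA; congr (_ * _); rewrite mulrC.
by rewrite mulrCA mulrAC vu mul1r.
Qed.

Lemma weierstrass_preparation f : f != 0 -> exists d, weierstrass_form f d.
Proof.
move=> /fps_content[mu [F [fE exn]]].
case: (ex_minnP exn) => n nP nmin.
have /choice[P PE] : forall i, exists c, (i < n)%N -> F i = l%:R * c.
  move=> i; case: (ltnP i n) => [ltin|]; last by exists 0.
  have /eqP/(padic_val_eq0 l_pr)[c cE] : F i 0%N == 0.
    by apply/negPn/negP => /nmin; rewrite leqNgt ltin.
  by exists c => _; rewrite cE expn1.
pose P' : fps Zl := FPS (fun i => if (i < n)%N then P i else 0).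
pose U := fps_drop n F.
have uU : U \is a GRing.unit by apply: fps_unit; apply: padic_res_unit.
have FE : F = l%:R * P' + fps_poly 'X^n * U.
  apply: fpsP => i; rewrite fps_coefD fps_coef_natM fps_coefXnM /=.
  by case: ltnP => [/PE->|h]; rewrite ?addr0 // mulr0 add0r subnK.
have [V VU uV] : exists2 V, V * U = 1 & V \is a GRing.unit.
  by exists U^-1; rewrite ?unitrV // mulVr.
clearbody P' U.
have [Z ZE] := fps_fixpoint n (P' * V).
have uZ : Z \is a GRing.unit.
  apply: fps_unit; apply: (padic_res_unit l_pr).
  have : (Z + l%:R * fps_drop n (P' * V * Z)) 0%N 0%N = 1 by rewrite ZE.
  rewrite fps_coefD fps_coef_natM padic_valD padic_valM l0 mul0r addr0 => ->.
  by rewrite oner_eq0.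
have [q uq qF] : exists2 q, q \is a GRing.unit &
    q * F = l%:R * (P' * V * Z) + fps_poly 'X^n * Z.
  exists (V * Z); first by rewrite unitrM uV.
  by rewrite FE (quot_eq _ _ _ _ VU).
have hi i : (q * F) (i + n)%N = (i == 0%N)%:R.
  rewrite -fps_coef1 -ZE qF !fps_coefD fps_coefXnM ltnNge leq_addl addnK.
  by rewrite addrC !fps_coef_natM.
pose g : {poly Zl} := \poly_(i < n.+1) (q * F) i.
have gn : g`_n = 1 by rewrite coef_poly ltnSn -[n]add0n hi.
have sg : size g = n.+1.
  by rewrite size_poly_eq // -[n]add0n hi oner_eq0.
have gE : fps_poly g = q * F.
  apply: fpsP => i; rewrite [LHS]coef_poly; case: ltnP => // ni.
  have := hi (i - n)%N; rewrite (subnK (ltnW ni)) => ->.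
  by rewrite eqn0Ngt subn_gt0 ni.
exists (mu, g); split=> /=.
  split; first by rewrite monicE /lead_coef sg /= gn.
  rewrite sg /= => i ltin; rewrite coef_poly ltnS (ltnW ltin) qF.
  exists ((P' * V * Z) i).
  by rewrite fps_coefD fps_coef_natM fps_coefXnM ltin addr0.
by exists q^-1; rewrite ?unitrV // fE gE mulrA mulrAC mulrK.
Qed.

End Weierstrass.

(* Main.v *)
(* Modulo l, n! times the n-th coefficient of f is L(X(X-1)...(X-n+1)), where
   L(P) is the sum over j of 2 P(0) - P(a_j) - P(-a_j) and a_j is the residue of
   alpha_j.  If l divided all coefficients of f up to index 2t, then L would
   vanish on the polynomials over F_l of degree at most 2t and less than l, since
   these are spanned by falling factorials.  On an even polynomial P with
   P(0) = 0 whose values at the a_j are 0 or a fixed c != 0, L counts, up to the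
   factor -2c, the indices with value c; as l is odd, l would divide this
   count, which is at most t < l and hence 0.  If 2t >= l, P = X^(l-1) counts
   all nonzero a_j; otherwise interpolation in X^2 isolates any given nonzero
   a_j^2.  So all a_j would be 0, contradicting admissibility.  Some coefficient
   of index at most 2t is thus a unit, which bounds the Weierstrass degree. *)
Require Import Defs.
From HB Require Import structures.
From mathcomp Require Import all_boot all_order all_algebra all_field.
From mathcomp Require Import boolp ring.
From mathcomp Require classical_sets.
Import Order.TTheory GRing.Theory Num.Theory.
Local Open Scope ring_scope.

Section Residue.
Variables (l : nat) (l_prime : prime l).

(* The primality proof is an argument so that the morphism instances can be
   inferred: the residue is not a morphism to ['F_l] for composite [l]. *)
Definition padic_residue (x : padic_int l) : 'F_l :=
  (let _ := l_prime in x 0%N : nat)%:R.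

(** The component [x 0%N] lives in ['Z_(l ^ 1)], a different type from ['F_l]; this identity
    reconciles the two reductions. *)
Let modn_residue k : (k %% (Zp_trunc (l ^ 1)).+2)%:R = k%:R :> 'F_l.
Proof.
have -> : (Zp_trunc (l ^ 1)).+2 = l by rewrite expn1 Zp_cast ?prime_gt1.
exact: Fp_nat_mod.
Qed.

Fact padic_residue_zmod_morphism : zmod_morphism padic_residue.
Proof.
have resD x y : padic_residue (x + y) = padic_residue x + padic_residue y.
  by rewrite /padic_residue /= modn_residue natrD.
by move=> x y; apply/(addIr (padic_residue y)); rewrite -resD !subrK.
Qed.

Fact padic_residue_monoid_morphism : monoid_morphism padic_residue.
Proof.
split=> [|x y]; first by rewrite /padic_residue /= modn_small.
by rewrite /padic_residue /= modn_residue natrM.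
Qed.

HB.instance Definition _ := GRing.isZmodMorphism.Build
  (padic_int l) 'F_l padic_residue padic_residue_zmod_morphism.
HB.instance Definition _ := GRing.isMonoidMorphism.Build
  (padic_int l) 'F_l padic_residue padic_residue_monoid_morphism.

Lemma padic_residue_eq0 x : (padic_residue x == 0) = (x 0%N == 0).
Proof.
have l1 : (1 < l ^ 1)%N by rewrite expn1 prime_gt1.
apply/idP/eqP => [/eqP/(congr1 val)|x0]; last by rewrite /padic_residue x0.
rewrite /= val_Fp_nat //= modn_small => [x0|]; first exact: ord_inj.
by apply: leq_trans (ltn_ord (x 0%N)) _; rewrite (Zp_cast l1) expn1.
Qed.

End Residue.

Arguments padic_residue {l}.
Arguments padic_residue_eq0 {l}.

Definition falling_poly (R : nzRingType) (n : nat) : {poly R} :=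
  \prod_(i < n) ('X - i%:R%:P).

(** Falling polynomials are monic, one in each degree, so subtracting a multiple of the last one
    lowers the size of [P]; no factorial is inverted. *)
Lemma falling_poly_ind (R : nzRingType) (K : {poly R} -> Prop) (N : nat) :
  K 0 -> (forall c P Q, K P -> K Q -> K (c *: P + Q)) ->
  (forall n, (n < N)%N -> K (falling_poly R n)) ->
  forall P : {poly R}, (size P <= N)%N -> K P.
Proof.
move=> K0 Klin; elim: N => [|N IH] KN P sP.
  by move: sP; rewrite leqn0 size_poly_eq0 => /eqP->.
rewrite -(subrK (P`_N *: falling_poly R N) P) addrC; apply: Klin; first exact: KN.
apply: IH => [n nN|]; first by apply: KN; apply: ltnW.
have sF : size (falling_poly R N) = N.+1.
  by rewrite /falling_poly size_prod_XsubC [index_enum _]unlock -enumT size_enum_ord.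
have lF : (falling_poly R N)`_N = 1.
  have /monicP := monic_prod_XsubC (index_enum 'I_N) xpredT (fun i => i%:R : R).
  by rewrite /lead_coef -/(falling_poly R N) sF.
apply/leq_sizeP => i; rewrite leq_eqVlt coefB coefZ => /orP[/eqP<-|Ni].
  by rewrite lF mulr1 subrr.
rewrite nth_default ?(leq_trans sP) // [X in _ * X]nth_default ?sF //.
by rewrite mulr0 subrr.
Qed.

(** The functional [L] of the overview. *)
Definition second_difference {R : nzRingType} {t : nat} (a : 'I_t -> R)
  (P : {poly R}) : R := \sum_(j < t) (2 * P.[0] - P.[a j] - P.[- a j]).

Lemma second_difference_linear (R : comNzRingType) (t : nat) (a : 'I_t -> R) (c : R)
    (P Q : {poly R}) :
  second_difference a (c *: P + Q) =
  c * second_difference a P + second_difference a Q.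
Proof.
rewrite /second_difference mulr_sumr -big_split; apply: eq_bigr => j _ /=.
by rewrite !hornerD !hornerZ; ring.
Qed.

Lemma second_difference_count (p t : nat) (a : 'I_t -> 'F_p) (P : {poly 'F_p})
    (A : {set 'I_t}) (c : 'F_p) :
  prime p -> odd p -> (t < p)%N -> c != 0 -> P.[0] = 0 ->
  (forall j, P.[a j] = if j \in A then c else 0) ->
  (forall j, P.[- a j] = P.[a j]) ->
  second_difference a P = 0 -> A = set0.
Proof.
move=> p_pr p_odd tp c0 P0 PA Peven; rewrite /second_difference.
rewrite (eq_bigr (fun j => if j \in A then - (c *+ 2) else 0)); last first.
  move=> j _; rewrite Peven PA P0 mulr0 sub0r.
  by case: ifP; rewrite ?subrr ?oppr0 ?addr0 // mulr2n opprD.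
rewrite -big_mkcond sumr_const -mulNrn -mulrnA => /eqP.
rewrite -mulr_natr mulf_eq0 oppr_eq0 (negbTE c0) /=.
rewrite -(dvdn_pcharf (pchar_Fp p_pr)) Euclid_dvdM // => /orP[/dvdn_leq|].
  move=> /(_ isT) p2; have := prime_gt1 p_pr; case: (p) p2 p_odd => [|[|[]]] //.
move=> pA; apply/eqP; rewrite -cards_eq0; move: pA; apply: contraLR.
rewrite -lt0n => A0; rewrite gtnNdvd // (leq_ltn_trans _ tp) //.
by rewrite -[X in (_ <= X)%N](card_ord t) max_card.
Qed.

(** The bound [minn (2 * t).+1 p] leaves room for the test polynomial of each case: ['X^(p.-1)] if
    [p <= 2 * t], an even polynomial of degree at most [2 * t] otherwise. *)
Lemma second_difference_inj0 (p t : nat) (a : 'I_t -> 'F_p) :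
  prime p -> odd p -> (t < p)%N ->
  (forall P : {poly 'F_p}, (size P <= minn (2 * t).+1 p)%N ->
     second_difference a P = 0) ->
  forall j, a j = 0.
Proof.
move=> p_pr p_odd tp aP.
have [pt|tp2] := leqP p (2 * t).
  have p1 : (0 < p.-1)%N by rewrite -ltnS prednK ?prime_gt1 ?prime_gt0.
  have Fermat (x : 'F_p) : x ^+ p.-1 = if x != 0 then 1 else 0.
    case: eqVneq => [->|x0] /=; first by rewrite expr0n eqn0Ngt p1.
    apply: (mulfI x0); rewrite -exprS prednK ?prime_gt0 // mulr1.
    by have := expf_card x; rewrite card_Fp.
  have /setP A0 : [set j | a j != 0] = set0.
    apply: (@second_difference_count p t a 'X^(p.-1) _ 1) => //.
    - by rewrite hornerXn Fermat eqxx.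
    - by move=> j; rewrite hornerXn Fermat inE.
    - by move=> j; rewrite !hornerXn !Fermat oppr_eq0.
    - apply: aP; rewrite size_polyXn prednK ?prime_gt0 // leq_min leqnn.
      by rewrite (leq_trans pt) ?leqnSn.
  by move=> j; have := A0 j; rewrite !inE => /negbFE/eqP.
move=> j0; apply/eqP/negPn/negP => aj0.
(* Repeated squares are harmless: only the zeros of [Q] matter, and its factor ['X] forces the value
   0 at 0. *)
pose s := [seq a j ^+ 2 | j <- enum 'I_t & (a j ^+ 2 != a j0 ^+ 2)].
pose Q : {poly 'F_p} := 'X * \prod_(d <- s) ('X - d%:P).
(* Strict since [j0] is filtered out; this pays for the factor ['X]. *)
have ss : (size s < t)%N.
  rewrite size_map size_filter.
  rewrite -[X in (_ < X)%N](size_enum_ord t).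
  rewrite -(count_predC (fun j => a j ^+ 2 != a j0 ^+ 2)) -[X in (X < _)%N]addn0.
  rewrite ltn_add2l -has_count.
  by apply/hasP; exists j0; rewrite ?mem_enum //= eqxx.
have sQ : (size Q <= t.+1)%N.
  rewrite /Q mulrC size_mulX ?monic_neq0 ?monic_prod_XsubC //.
  by rewrite size_prod_XsubC ltnS.
have QE x : Q.[x] = x * \prod_(d <- s) (x - d).
  by rewrite hornerM hornerX horner_prod; congr (_ * _);
     apply: eq_bigr => d _; rewrite hornerXsubC.
have PE x : (Q \Po 'X^2).[x] = Q.[x ^+ 2] by rewrite horner_comp hornerXn.
have /setP A0 : [set j | a j ^+ 2 == a j0 ^+ 2] = set0.
  apply: (@second_difference_count p t a (Q \Po 'X^2) _ (Q.[a j0 ^+ 2])) => //.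
  - rewrite QE mulf_neq0 ?expf_neq0 //; rewrite prodf_seq_neq0.
    apply/allP => d /mapP[j]; rewrite mem_filter.
    by move=> /andP[/= aj _] ->; rewrite subr_eq0 eq_sym.
  - by rewrite PE QE expr0n mul0r.
  - move=> j; rewrite inE PE; case: eqP => [-> //|/eqP aj].
    rewrite QE; apply/eqP; rewrite mulf_eq0; apply/orP; right.
    rewrite prodf_seq_eq0; apply/hasP; exists (a j ^+ 2); rewrite ?subrr ?eqxx //.
    by apply: map_f; rewrite mem_filter aj mem_enum.
  - by move=> j; rewrite !PE sqrrN.
  - apply: aP; have /minn_idPl-> : ((2 * t).+1 <= p)%N by [].
    apply: leq_trans (size_comp_poly_leq _ _) _.
    by rewrite size_polyXn /= ltnS mulnC leq_mul2l /= -subn1 leq_subLR add1n.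
by have := A0 j0; rewrite !inE eqxx.
Qed.

(** Keeping the factorial on the left avoids a division that fails in ['F_l] once [l <= n]. *)
Lemma bouquet_series_residue (l t : nat) (alpha : 'I_t -> padic_int l)
    (l_prime : prime l) (n : nat) :
  n`!%:R * padic_residue l_prime (bouquet_series alpha n) =
  second_difference (fun j => padic_residue l_prime (alpha j))
    (falling_poly 'F_l n).
Proof.
have E b : n`!%:R * padic_residue l_prime (padic_bin b n) =
    (falling_poly 'F_l n).[padic_residue l_prime b].
  rewrite -[n`!%:R](rmorph_nat (padic_residue l_prime)) -rmorphM padic_binP //.
  rewrite rmorph_prod horner_prod; apply: eq_bigr => i _.
  by rewrite hornerXsubC rmorphB rmorph_nat.
(* For [n > 0] both sides vanish, 0 being a root of the falling polynomial. *)
have E2 : n`!%:R * padic_residue l_prime ((2%:R : fps (padic_int l)) n) =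
    2 * (falling_poly 'F_l n).[0].
  rewrite -[2%:R]mulr1 fps_coef_natM fps_coef1 rmorphM !rmorph_nat /falling_poly.
  rewrite horner_prod; case: n {E} => [|n]; first by rewrite big_ord0 mul1r.
  by rewrite big_ord_recl hornerXsubC subr0 mul0r !mulr0.
rewrite /bouquet_series fps_coef_sum rmorph_sum mulr_sumr /second_difference.
apply: eq_bigr => j _; rewrite 2!fps_coefD 2!fps_coefN !rmorphB !mulrBr.
by congr (_ - _ - _); [apply: E2 | apply: E | rewrite -rmorphN; apply: E].
Qed.

Lemma bouquet_series_unit_coef (l t : nat) (alpha : 'I_t -> padic_int l) :
  prime l -> odd l -> admissible alpha -> (t < l)%N ->
  exists2 n, (n <= 2 * t)%N & bouquet_series alpha n 0%N != 0.
Proof.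
move=> l_pr l_odd adm tl; apply: contrapT => H; apply: adm => j.
suff /eqP : padic_residue l_pr (alpha j) = 0.
  by rewrite padic_residue_eq0 => /eqP/(padic_val_eq0 l_pr)[c]; rewrite expn1; exists c.
move: j; apply: second_difference_inj0 => //.
apply: falling_poly_ind => [|c P Q P0 Q0|n].
- by apply: big1 => j _; rewrite !horner0 mulr0 !subr0.
- by rewrite second_difference_linear P0 Q0 mulr0 addr0.
rewrite leq_min => /andP[nt _]; rewrite -bouquet_series_residue.
case: (eqVneq (bouquet_series alpha n 0%N) 0) => [|nz]; last by case: H; exists n.
by move/eqP; rewrite -(padic_residue_eq0 l_pr) => /eqP->; rewrite mulr0.
Qed.

(** Below the degree of the distinguished factor [g], the coefficients of [g * u] are divisible by
    [l], hence so are those of [f], whatever the power of [l] in front. *)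
Lemma weierstrass_degree_le (l : nat) (f : fps (padic_int l)) (n : nat) :
  prime l -> f n 0%N != 0 -> ((size (weierstrass f).2).-1 <= n)%N.
Proof.
move=> l_pr fn; have f0 : f != 0 by apply: contraNneq fn => ->.
have := classical_sets.xgetPex (0%N, 0) (weierstrass_preparation l_pr f0).
rewrite -/(weierstrass f); case: (weierstrass f) => [m g] [/= gd [u uu fE]].
rewrite leqNgt; apply: contra fn => ng.
rewrite fE -mulrA fps_coef_natXM padic_valM.
have /eqP -> : (fps_poly g * u) n 0%N == 0.
  by rewrite (distinguished_res l_pr gd uu (ltnW ng)).
by rewrite mulr0.
Qed.

Theorem theorem4p13 (l t : nat) (alpha : 'I_t -> padic_int l)
  (l_prime : prime l) (l_odd : odd l) (t_ge2 : (2 <= t)%N)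
  (alpha_adm : admissible alpha) (t_lt_l : (t < l)%N) :
  lambda_inv alpha < (2 * t)%N%:Z.
Proof.
have [n nt /(weierstrass_degree_le l _ _ l_prime) dn] :=
  bouquet_series_unit_coef l t alpha l_prime l_odd alpha_adm t_lt_l.
(* The shift by [- 1] in [lambda_inv] turns degree at most [2 * t] into the strict bound. *)
by rewrite /lambda_inv ltrBlDr ltz_nat addn1 ltnS (leq_trans dn).
Qed.
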